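(* Let $n\geqslant 1$. An $n$-valued group of order $3$, on a set $X=\{e,x_1,x_2\}$ with unit $e$, is non-reversible if and only if it belongs to the series $B_2$ with $$b_0\bigl(a_0+b_0(n-b_0-b_1)+a_0b_1-a_1b_0\bigr)>0 .$$
   Context: $\mathrm{Sym}^n(X)=X^{n}/S_n$ is the set of $n$-element multisets of elements of $X$; a multiset is written as a formal sum $\sum_{x\in X} m_x\, x$ with non-negative integer multiplicities summing to $n$. An $n$-valued monoid is a set $X$ with an operation $\ast:X\times X\to \mathrm{Sym}^n(X)$ such that: (associativity) for all $x,y,z\in X$ the $n^2$-multisets $[x\ast w\mid w\in y\ast z]$ and $[w\ast z\mid w\in x\ast y]$ coincide (with $w$ running with multiplicity); (unit) there is $e\in X$ with $e\ast x=x\ast e=[x,\dots,x]$ ($n$ times) for every $x\in X$. Its order is $|X|$. An $n$-valued group is an $n$-valued monoid equipped with a map $\mathrm{inv}:X\to X$ such that $e\in x\ast \mathrm{inv}(x)$ and $e\in \mathrm{inv}(x)\ast x$ for every $x\in X$. For an $n$-valued group put $\mathrm{Inv}(x)=\{y\in X\mid e\in x\ast y,\ e\in y\ast x\}$. The group is reversible if $\mathrm{inv}=\mathrm{Inv}$, i.e. $\mathrm{Inv}(x)=\{\mathrm{inv}(x)\}$ for every $x\in X$ (equivalently, the inverse map is uniquely determined); otherwise it is non-reversible. An $n$-valued monoid structure on $X=\{e,x_1,x_2\}$ with unit $e$ is given by the $4\times3$ matrix $B$ whose rows list, in order, the multiplicities of $(e,x_1,x_2)$ in $x_1\ast x_1$,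 $x_1\ast x_2$, $x_2\ast x_1$, $x_2\ast x_2$. It belongs to the series $B_2$ if its matrix has the form $$B_2=\begin{pmatrix} a_0&a_1&n-a_0-a_1\\ b_0&b_1&n-b_0-b_1\\ b_0&b_1&n-b_0-b_1\\ \frac{b_0(n-b_0-b_1)+a_0b_1-a_1b_0}{n-a_0-a_1} & \frac{(b_0+b_1)(n-b_1)}{n-a_0-a_1} & \frac{(n-b_0-b_1)^2+n(b_1-a_0-a_1)+a_1b_0-a_0b_1}{n-a_0-a_1}\end{pmatrix}\quad (n-a_0-a_1\neq 0),$$ where $a_0,a_1,b_0,b_1$ are parameters and all entries are non-negative integers. *)

(* Defs.v *)
From mathcomp Require Import all_boot all_order all_algebra.
From mathcomp Require Import finmap multiset.

Set Implicit Arguments.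
Unset Strict Implicit.
Unset Printing Implicit Defensive.

Import GRing.Theory Num.Theory.

Local Open Scope mset_scope.

Record Sym (n : nat) (X : choiceType) := MkSym {
  Sym_mset :> {mset X};
  Sym_size : size Sym_mset == n
}.

(* In [\big[msetD/mset0]_(w <- M) F w] the index [w] runs over the enumeration
   of the multiset [M] with repetitions, so the sum is the multiset union of
   the [F w] with [w] taken with its multiplicity. *)
Record nvMonoid (n : nat) (X : choiceType) := NvMonoid {
  nv_op : X -> X -> Sym n X;
  nv_unit : X;
  nv_assoc : forall x y z : X,
    \big[msetD/mset0]_(w <- nv_op y z) (nv_op x w : {mset X}) =
    \big[msetD/mset0]_(w <- nv_op x y) (nv_op w z : {mset X});
  nv_unitl : forall x : X, nv_op nv_unit x = msetn n x :> {mset X};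
  nv_unitr : forall x : X, nv_op x nv_unit = msetn n x :> {mset X}
}.

Record nvGroup (n : nat) (X : choiceType) := NvGroup {
  nv_monoid :> nvMonoid n X;
  nv_inv : X -> X;
  nv_invr : forall x : X,
    nv_unit nv_monoid \in (nv_op nv_monoid x (nv_inv x) : {mset X});
  nv_invl : forall x : X,
    nv_unit nv_monoid \in (nv_op nv_monoid (nv_inv x) x : {mset X})
}.

Definition nv_Inv (n : nat) (X : choiceType) (G : nvGroup n X) (x : X)
    : {pred X} :=
  [pred y | (nv_unit G \in (nv_op G x y : {mset X})) &&
            (nv_unit G \in (nv_op G y x : {mset X}))].

Definition nv_reversible (n : nat) (X : choiceType) (G : nvGroup n X) : Prop :=
  forall x : X, nv_Inv G x =i pred1 (nv_inv G x).

Definition nv_order (n : nat) (X : finType) (M : nvMonoid n X) : nat := #|X|.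

Local Open Scope ring_scope.

Definition mx_of_rows (R : Type) (x0 : R) (p q : nat) (s : seq (seq R))
    : 'M[R]_(p, q) :=
  \matrix_(i < p, j < q) nth x0 (nth [::] s i) j.

Definition nv_matrix (n : nat) (X : choiceType) (M : nvMonoid n X) (x1 x2 : X)
    : 'M[nat]_(4, 3) :=
  mx_of_rows 0%N 4 3
    [seq [seq Sym_mset m x | x <- [:: nv_unit M; x1; x2]]
       | m <- [:: nv_op M x1 x1; nv_op M x1 x2; nv_op M x2 x1; nv_op M x2 x2]].

Definition B2_matrix (n a0 a1 b0 b1 : rat) : 'M[rat]_(4, 3) :=
  mx_of_rows 0 4 3
    [:: [:: a0; a1; n - a0 - a1];
        [:: b0; b1; n - b0 - b1];
        [:: b0; b1; n - b0 - b1];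
        [:: (b0 * (n - b0 - b1) + a0 * b1 - a1 * b0) / (n - a0 - a1);
            ((b0 + b1) * (n - b1)) / (n - a0 - a1);
            ((n - b0 - b1) ^+ 2 + n * (b1 - a0 - a1) + a1 * b0 - a0 * b1)
              / (n - a0 - a1)]].

(* The entries of [B] are natural numbers, so the equality also expresses that
   all the entries of the matrix of the series, in particular the parameters,
   are non-negative integers. *)
Definition in_series_B2 (n : nat) (a0 a1 b0 b1 : int) (B : 'M[nat]_(4, 3))
    : Prop :=
  n%:Z - a0 - a1 != 0 /\
  map_mx (fun k : nat => k%:R) B =
    B2_matrix n%:R a0%:~R a1%:~R b0%:~R b1%:~R.

(* Main.v *)
Require Import Defs.
From mathcomp Require Import all_boot all_order all_algebra.
From mathcomp Require Import zify ring lra.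
From mathcomp Require Import finmap multiset.

Set Implicit Arguments.
Unset Strict Implicit.
Unset Printing Implicit Defensive.

Import GRing.Theory Num.Theory.

Local Open Scope mset_scope.
Local Open Scope ring_scope.

(** Write [a], [b], [c], [d] for the vectors of multiplicities of
    [x1 * x1], [x1 * x2], [x2 * x1], [x2 * x2] in the coordinates [e, x1, x2].

    The relation [y \in Inv x] is symmetric and relates [e] only to itself.  As
    [inv x] always lies in [Inv x], non-reversibility means that some [Inv x]
    has two elements; at order three these can only be [x1] and [x2], so the
    group is non-reversible exactly when [x2 \in Inv x1] and one of [x1], [x2]
    is an inverse of itself ([nv_nonreversible3P]): [b_0, c_0 > 0] and
    [a_0 + d_0 > 0].

    Membership in the series follows from [b_0 > 0] ([nv_series_B2]).
    Associativity of [x1 * x1 * x2] reads, as an identity of vectors,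
      [a_2 d = b_0 n x1 + b_1 a + b_2 b - a_0 n x2 - a_1 b].
    If [a_2 = 0], its [x1]-coordinate is [0 = n b_0 + b_1 b_2], contradicting
    [b_0 > 0].  So [a_2 <> 0]; then associativity of [x1 * x1 * x1], which is
    [a_2 (b - c) = 0], gives [b = c], and the identity above can be
    solved for [d], which gives the last row of the matrix.

    On the series, [c_0 = b_0] and the second factor of the inequality is
    [a_0 + a_2 d_0] with [a_2 > 0], so the inequality says that [b_0, c_0 > 0]
    and that [a_0] or [d_0] is positive ([series_B2_pos]). *)

(** * Multiplicities in multiset sums *)

Lemma mset_bigD (I : Type) (K : choiceType) (r : seq I) (F : I -> {mset K})
    (y : K) :
  (\big[msetD/mset0]_(w <- r) F w) y = (\sum_(w <- r) F w y)%N.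
Proof.
elim: r => [|w r IHr]; first by rewrite !big_nil mset0E.
by rewrite !big_cons msetE2 IHr.
Qed.

Lemma sum_mset_fin (X : finType) (A : {mset X}) (f : X -> nat) :
  (\sum_(w <- A) f w = \sum_w A w * f w)%N.
Proof.
rewrite [RHS](eq_bigr (fun w => count_mem w (A : seq X) * f w)%N); last first.
  by move=> w _; rewrite count_mem_mset.
elim: (A : seq X) => [|a s IHs]; first by rewrite big_nil big1.
rewrite big_cons IHs [RHS](eq_bigr _ (fun w _ => mulnDl _ _ _)) big_split /=.
congr addn; rewrite (bigD1 a) //= eqxx mul1n big1 ?addn0 // => w.
by rewrite eq_sym => /negPf ->.
Qed.

(** * Structure constants of a finite n-valued monoid *)

Section StructureConstants.
Variables (n : nat) (X : finType) (M : nvMonoid n X).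
Implicit Types x y z t : X.

Let m x y : {mset X} := nv_op M x y.

Lemma nv_mult_sum x y : (\sum_t m x y t = n)%N.
Proof.
rewrite -(eqP (Sym_size (nv_op M x y))) -sum1_size sum_mset_fin.
by apply: eq_bigr => t _; rewrite muln1.
Qed.

Lemma nv_mult_assoc x y z t :
  (\sum_w m y z w * m x w t = \sum_w m x y w * m w z t)%N.
Proof. by rewrite -!sum_mset_fin -!mset_bigD /m nv_assoc. Qed.

Lemma nv_mult_unitl x y : m (nv_unit M) x y = (if y == x then n else 0)%N.
Proof. by rewrite /m nv_unitl msetnE. Qed.

Lemma nv_mult_unitr x y : m x (nv_unit M) y = (if y == x then n else 0)%N.
Proof. by rewrite /m nv_unitr msetnE. Qed.

End StructureConstants.

(** * Inverses and reversibility *)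

Section Inverses.
Variables (n : nat) (X : choiceType) (G : nvGroup n X).
Implicit Types x y z : X.

Lemma nv_Inv_sym x y : (y \in nv_Inv G x) = (x \in nv_Inv G y).
Proof. by rewrite !inE andbC. Qed.

Lemma nv_inv_Inv x : nv_inv G x \in nv_Inv G x.
Proof. by rewrite inE nv_invr nv_invl. Qed.

Lemma nv_Inv_unit y : y \in nv_Inv G (nv_unit G) -> y = nv_unit G.
Proof. by rewrite inE nv_unitl in_msetn => /andP[/andP[_ /eqP]]. Qed.

(** Every [Inv x] contains [inv x], so only uniqueness is at stake; this removes
    the chosen map [inv] from the notion. *)
Lemma nv_reversibleP :
  nv_reversible G <->
  forall x y z, y \in nv_Inv G x -> z \in nv_Inv G x -> y = z.
Proof.
split=> [revG x y z | uniqG x y]; first by rewrite !revG => /eqP-> /eqP->.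
apply/idP/eqP=> [Ixy | ->]; last exact: nv_inv_Inv.
exact: uniqG Ixy (nv_inv_Inv x).
Qed.

End Inverses.

(** * Order three *)

Section OrderThree.
Variables (n : nat) (X : finType) (x1 x2 : X).
Hypothesis n_gt0 : (0 < n)%N.

Section Monoid.
Variable M : nvMonoid n X.
Hypothesis uniqX : uniq [:: nv_unit M; x1; x2].
Hypothesis defX : forall x, x \in [:: nv_unit M; x1; x2].

Lemma sum_order3 (f : X -> nat) :
  (\sum_w f w = f (nv_unit M) + f x1 + f x2)%N.
Proof.
rewrite -(eq_bigl _ _ defX) -big_uniq //=.
by rewrite !big_cons big_nil addn0 addnA.
Qed.

(** Associativity of [x1 * x1 * x1] and [x1 * x1 * x2] yields all that the series
    prescribes: first [a2 > 0], then [c = b], then [d]. *)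
Lemma nv_series_B2 :
  nv_unit M \in (nv_op M x1 x2 : {mset X}) ->
  let a := Sym_mset (nv_op M x1 x1) in let b := Sym_mset (nv_op M x1 x2) in
  in_series_B2 n (a (nv_unit M)) (a x1) (b (nv_unit M)) (b x1)
    (nv_matrix M x1 x2).
Proof.
rewrite in_mset => b0_gt0 a b.
set c := Sym_mset (nv_op M x2 x1); set d := Sym_mset (nv_op M x2 x2).
have /and3P[] : [&& x1 != nv_unit M, x2 != nv_unit M & x2 != x1].
  move: uniqX; rewrite /= !inE negb_or !(eq_sym _ x1) (eq_sym _ x2) => /and3P[].
  by rewrite (eq_sym x1 x2) => /andP[-> ->] ->.
set e := nv_unit M in b0_gt0 *; rewrite -/(b e) in b0_gt0.
move=> /negPf x1e /negPf x2e /negPf x21.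
have ex1 : (e == x1) = false by rewrite eq_sym.
have ex2 : (e == x2) = false by rewrite eq_sym.
have x12 : (x1 == x2) = false by rewrite eq_sym.
have multE := (nv_mult_unitl, nv_mult_unitr, eqxx, x1e, x2e, x21, ex1, ex2, x12).
have sum_a : (a e + a x1 + a x2 = n)%N by rewrite -sum_order3 nv_mult_sum.
have sum_b : (b e + b x1 + b x2 = n)%N by rewrite -sum_order3 nv_mult_sum.
(* The common contribution of [e] and [x1] to both sides cancels. *)
have assoc111 t : (a x2 * b t = a x2 * c t)%N.
  have := nv_mult_assoc M x1 x1 x1 t; rewrite !sum_order3 !multE.
  by rewrite -/a -/b -/c => /addnI.
have assoc112 t :
    (b e * (if t == x1 then n else 0) + b x1 * a t + b x2 * b t =
     a e * (if t == x2 then n else 0) + a x1 * b t + a x2 * d t)%N.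
  have := nv_mult_assoc M x1 x1 x2 t.
  by rewrite !sum_order3 nv_mult_unitl nv_mult_unitr.
have a2_gt0 : (0 < a x2)%N.
  rewrite lt0n; apply/eqP => a2_0.
  (* With [a2 = 0] the coordinate at [x1] reads [b0 n + b1 b2 = 0]. *)
  have := assoc112 x1; rewrite !multE a2_0.
  move: (muln_gt0 (b e) n); rewrite b0_gt0 n_gt0; lia.
have cb t : c t = b t.
  by apply/eqP; rewrite -(eqn_pmul2l a2_gt0) assoc111.
have a2E : (n%:R - (a e)%:R - (a x1)%:R = (a x2)%:R :> rat).
  by rewrite -sum_a !natrD; ring.
have b2E : (n%:R - (b e)%:R - (b x1)%:R = (b x2)%:R :> rat).
  by rewrite -sum_b !natrD; ring.
have a2_neq0 : ((a x2)%:R != 0 :> rat) by rewrite pnatr_eq0 -lt0n.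
have assocQ t := congr1 (fun k => k%:R : rat) (assoc112 t).
split; first by have := a2_gt0; lia.
apply/matrixP => i j; rewrite !mxE -!pmulrn a2E b2E.
case: i j => [[|[|[|[|//]]]] ?] [[|[|[|//]]] ?] //=; rewrite -/e ?cb -/a -/b -/d //.
- apply/(mulIf a2_neq0); rewrite divfK //.
  by move: (assocQ e); rewrite !multE !(natrD, natrM); lra.
- apply/(mulIf a2_neq0); rewrite divfK //.
  move: (assocQ x1); rewrite !multE !(natrD, natrM) -b2E.
  by lra.
- apply/(mulIf a2_neq0); rewrite divfK //.
  move: (assocQ x2); rewrite !multE !(natrD, natrM) -b2E -a2E.
  by lra.
Qed.

(** The first entry of the last row of the series says that the second factor
    of the inequality is [a0 + a2 d0], where [a2], the denominator in that row, is
    a nonzero multiplicity and hence positive; rows two and three give [b0 = c0]. *)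
Lemma series_B2_pos (a0 a1 b0 b1 : int) :
  in_series_B2 n a0 a1 b0 b1 (nv_matrix M x1 x2) ->
  (0 < b0 * (a0 + b0 * (n%:Z - b0 - b1) + a0 * b1 - a1 * b0)) =
  [&& nv_unit M \in (nv_op M x1 x2 : {mset X}),
      nv_unit M \in (nv_op M x2 x1 : {mset X}) &
      (nv_unit M \in (nv_op M x1 x1 : {mset X})) ||
      (nv_unit M \in (nv_op M x2 x2 : {mset X}))].
Proof.
case=> a2_neq0 /matrixP matE; rewrite !in_mset.
have toInt (k : nat) (z : int) : k%:R = z%:~R :> rat -> z = k%:Z.
  by rewrite pmulrn => /intr_inj.
have entry i j (Hi : (i < 4)%N) (Hj : (j < 3)%N) :=
  matE (Ordinal Hi) (Ordinal Hj).
have := entry 0%N 0%N isT isT; rewrite !mxE /= => /toInt a0E.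
have := entry 0%N 2%N isT isT.
rewrite !mxE /= !pmulrn -!intrB => /intr_inj a2E.
have := entry 1%N 0%N isT isT; rewrite !mxE /= => /toInt b0E.
have := entry 2%N 0%N isT isT; rewrite !mxE /= => /toInt c0E.
have := entry 3%N 0%N isT isT; rewrite !mxE /= => d0E.
have {}d0E : b0 * (n%:Z - b0 - b1) + a0 * b1 - a1 * b0 =
    (Sym_mset (nv_op M x2 x2) (nv_unit M))%:Z * (n%:Z - a0 - a1).
  apply: (@intr_inj rat); rewrite intrM -pmulrn d0E.
  have den_neq0 : (n%:R - a0%:~R - a1%:~R != 0 :> rat).
    by rewrite pmulrn -!intrB intr_eq0.
  by rewrite !(intrB, intrD, intrM) -!pmulrn divfK.
have -> : a0 + b0 * (n%:Z - b0 - b1) + a0 * b1 - a1 * b0 =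
    a0 + (Sym_mset (nv_op M x2 x2) (nv_unit M))%:Z * (n%:Z - a0 - a1).
  by rewrite -d0E; ring.
rewrite -a2E a0E b0E.
have -> : Sym_mset (nv_op M x2 x1) (nv_unit M) =
    Sym_mset (nv_op M x1 x2) (nv_unit M).
  by have := c0E; rewrite b0E => -[].
have a2_gt0 : (0 < Sym_mset (nv_op M x1 x1) x2)%N.
  by rewrite lt0n -eqz_nat a2E.
have -> (p q r s : nat) : p%:Z * (q%:Z + r%:Z * s%:Z) = (p * (q + r * s))%N%:Z.
  by rewrite PoszM PoszD PoszM.
by rewrite ltz_nat muln_gt0 addn_gt0 muln_gt0 a2_gt0 andbT andbA andbb.
Qed.

End Monoid.

Variable G : nvGroup n X.
Hypothesis defX : forall x, x \in [:: nv_unit G; x1; x2].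

(** [x2 \in Inv x1] is symmetric, so it is half of non-uniqueness both for
    [Inv x1] and for [Inv x2]. *)
Lemma nv_nonreversible3P : uniq [:: nv_unit G; x1; x2] ->
  ~ nv_reversible G <->
  (x2 \in nv_Inv G x1) && ((x1 \in nv_Inv G x1) || (x2 \in nv_Inv G x2)).
Proof.
move=> uniqX.
have Inv_neq_unit x y : y \in nv_Inv G x -> (y == nv_unit G) = (x == nv_unit G).
  move=> Ixy; apply/eqP/eqP => [ye | xe].
    by apply: nv_Inv_unit; rewrite -ye nv_Inv_sym.
  by apply: nv_Inv_unit; rewrite -xe.
split=> [nrevG | /andP[I12 Iself] /nv_reversibleP uniqG]; last first.
  have x12 : x1 = x2.
    case/orP: Iself => [I11 | I22]; first exact: uniqG I11 I12.
    by apply: (uniqG x2); rewrite // nv_Inv_sym.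
  by move: uniqX; rewrite /= !inE x12 eqxx !andbF.
(* Two distinct inverses of [x] are [x1] and [x2], and [x] is one of them. *)
apply: contra_notT nrevG => noI; apply/nv_reversibleP => x y z Ixy Ixz.
have xyz := (Inv_neq_unit _ _ Ixy, Inv_neq_unit _ _ Ixz).
case: (eqVneq x (nv_unit G)) xyz => [_ [/eqP-> /eqP->] // | xe [ye ze]].
move: (defX x) (defX y) (defX z) Ixy Ixz noI; rewrite !(in_cons, in_nil).
rewrite (negPf xe) ye ze !orbF /=.
case/orP=> /eqP-> /orP[] /eqP-> /orP[] /eqP-> //; rewrite ?(nv_Inv_sym G x2 x1).
all: by move=> -> ->; rewrite ?orbT.
Qed.

End OrderThree.

Theorem corollary4 (n : nat) (X : finType) (G : nvGroup n X) (x1 x2 : X) :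
  (1 <= n)%N ->
  nv_order G = 3%N ->
  [set: X]%SET = [set nv_unit G; x1; x2]%SET ->
  ~ nv_reversible G <->
  exists a0 a1 b0 b1 : int,
    in_series_B2 n a0 a1 b0 b1 (nv_matrix G x1 x2) /\
    0 < b0 * (a0 + b0 * (n%:Z - b0 - b1) + a0 * b1 - a1 * b0).
Proof.
move=> n_gt0 oG setX.
have defX x : x \in [:: nv_unit G; x1; x2].
  by have := in_setT x; rewrite setX !inE orbA.
have uniqX : uniq [:: nv_unit G; x1; x2].
  apply/card_uniqP; rewrite /= -oG; apply: eq_card => x.
  by rewrite defX.
rewrite (nv_nonreversible3P defX uniqX).
split=> [/andP[I12 Iself] | [a0 [a1 [b0 [b1 [BG]]]]]].
  have := I12; rewrite inE => /andP[b0_gt0 c0_gt0].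
  have BG := nv_series_B2 n_gt0 uniqX defX b0_gt0.
  do 4 eexists; split; first exact: BG.
  by rewrite (series_B2_pos BG) b0_gt0 c0_gt0; move: Iself; rewrite !inE !andbb.
by rewrite (series_B2_pos BG) !inE !andbb => /and3P[-> ->].
Qed.
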